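(* Let $K$ be a field of characteristic zero and $n\ge1$. The algebra $\mathbb{I}_n$ is a maximal left order in $Q_l(\mathbb{I}_n)$ and a maximal right order in $Q_r(\mathbb{I}_n)$.
   Context: $\mathbb{I}_n=K\langle x_1,\ldots,x_n,\partial_1,\ldots,\partial_n,\int_1,\ldots,\int_n\rangle$ is the subalgebra of $\mathrm{End}_K(K[x_1,\ldots,x_n])$ generated by the multiplications by $x_i$, the partial derivatives $\partial_i=\partial/\partial x_i$ and the integrations $\int_i$, i.e. the $K$-linear maps $x_1^{\alpha_1}\cdots x_n^{\alpha_n}\mapsto(\alpha_i+1)^{-1}x_i\,x_1^{\alpha_1}\cdots x_n^{\alpha_n}$. For any ring $R$, let $\mathcal{C}_R(0)$ be the set of regular elements (elements $x$ such that $xr=0$ implies $r=0$ and $rx=0$ implies $r=0$). It is known that every ring $R$ has a largest (with respect to inclusion) left denominator set $S_{l,0}(R)$ contained in $\mathcal{C}_R(0)$ and a largest right denominator set $S_{r,0}(R)$ contained in $\mathcal{C}_R(0)$. The rings $Q_l(R)=S_{l,0}(R)^{-1}R$ and $Q_r(R)=RS_{r,0}(R)^{-1}$ are called the largest left, respectively right, quotient ring of $R$; $R$ is a subring of each. A subring $S$ (not necessarily with $1$) of $Q_r(R)$ is a right order in $Q_r(R)$ if each $q\in Q_r(R)$ has the form $q=rs^{-1}$ for some $r,s\in S$. A subring $S$ (not necessarily with $1$) of $Q_l(R)$ is a left order in $Q_l(R)$ if each $q\in Q_l(R)$ has the form $q=s^{-1}r$ for some $r,s\in S$. Two right orders $R_1,R_2$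 in $Q_r(\mathbb{I}_n)$ are equivalent, $R_1\sim R_2$, if there are units $a_1,a_2,b_1,b_2$ of $Q_r(\mathbb{I}_n)$ with $a_1R_1b_1\subseteq R_2$ and $a_2R_2b_2\subseteq R_1$; this is an equivalence relation on right orders. A right order in $Q_r(\mathbb{I}_n)$ is a maximal right order if it is maximal with respect to $\subseteq$ within its equivalence class. Equivalence of left orders in $Q_l(\mathbb{I}_n)$ and maximal left orders are defined in the same way, with units of $Q_l(\mathbb{I}_n)$ and left orders in $Q_l(\mathbb{I}_n)$. *)

(* Defs.v *)
From HB Require Import structures.
From mathcomp Require Import all_boot all_order all_algebra.
From mathcomp Require Import boolp classical_sets ssrcomplements mpoly.

Set Implicit Arguments.
Unset Strict Implicit.
Unset Printing Implicit Defensive.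

Import GRing.Theory.
Local Open Scope ring_scope.
Local Open Scope classical_set_scope.

(* Rings are associative with 1, not necessarily commutative; pzRingType also
   allows the zero ring.  Multiplicative sets are not explicitly required to
   avoid 0: over a nonzero ring this is automatic for sets of regular elements. *)

Section Denominators.
Variable R : pzRingType.
Implicit Types (r s t x y z : R) (S T : set R).

Definition regular : set R :=
  [set x | (forall r, x * r = 0 -> r = 0) /\ (forall r, r * x = 0 -> r = 0)].

Definition multiplicative S := S 1 /\ forall s t, S s -> S t -> S (s * t).

Definition left_denominator S :=
  [/\ multiplicative S,
      forall s r, S s -> exists s' r', S s' /\ s' * r = r' * s
    & forall s r, S s -> r * s = 0 -> exists s', S s' /\ s' * r = 0].

Definition right_denominator S :=
  [/\ multiplicative S,
      forall s r, S s -> exists s' r', S s' /\ r * s' = s * r'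
    & forall s r, S s -> s * r = 0 -> exists s', S s' /\ r * s' = 0].

(* The union of all left (right) denominator sets of regular elements; it is
   itself one, hence the largest one: see Sl0_largest and Sr0_largest. *)
Definition Sl0 : set R :=
  [set x | exists S, [/\ left_denominator S, S `<=` regular & S x]].

Definition Sr0 : set R :=
  [set x | exists S, [/\ right_denominator S, S `<=` regular & S x]].

Inductive generated_monoid (G : set R) : set R :=
| gen_one : generated_monoid G 1
| gen_mul s x : G s -> generated_monoid G x -> generated_monoid G (s * x).

Lemma Sl0_regular : Sl0 `<=` regular.
Proof. by move=> x [S [_ + Sx]]; apply. Qed.

Lemma Sl0_max S : left_denominator S -> S `<=` regular -> S `<=` Sl0.
Proof. by move=> dS rS x Sx; exists S. Qed.

Lemma Sl0_left_denominator : left_denominator Sl0.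
Proof.
set M := generated_monoid Sl0.
have Mmul s t : M s -> M t -> M (s * t).
  move=> + Mt; elim=> [|u x Gu _ IH]; first by rewrite mul1r.
  by rewrite -mulrA; apply: gen_mul.
have subM s : Sl0 s -> M s.
  by move=> Gs; rewrite -[s]mulr1; exact: gen_mul Gs (gen_one _).
have regM : M `<=` regular.
  move=> x; elim=> [|s y /Sl0_regular[sl sr] _ [yl yr]].
    by split=> r; rewrite (mul1r, mulr1).
  split=> r; first by rewrite -mulrA => /sl/yl.
  by rewrite mulrA => /yr/sr.
have dM : left_denominator M.
  split; first by split=> //; apply: gen_one.
    move=> s + Ms; elim: Ms => [r|u x Gu _ IH r].
      by exists 1, r; split; [exact: gen_one | rewrite mul1r mulr1].
    have [s1 [r1 [Ms1 e1]]] := IH r.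
    have [S [dS rS Su]] := Gu; have [_ oreS _] := dS.
    have [s2 [r2 [Ss2 e2]]] := oreS u r1 Su.
    exists (s2 * s1), r2; split.
      by apply: Mmul => //; apply: subM; exists S.
    by rewrite -mulrA e1 mulrA e2 -mulrA.
  move=> s r /regM[_ sr] /sr ->; exists 1; split; first exact: gen_one.
  by rewrite mulr0.
have eqM : Sl0 = M by apply/seteqP; split=> //; apply: Sl0_max.
by rewrite eqM.
Qed.

Lemma Sl0_largest :
  [/\ left_denominator Sl0, Sl0 `<=` regular
    & forall S, left_denominator S -> S `<=` regular -> S `<=` Sl0].
Proof.
split; [exact: Sl0_left_denominator | exact: Sl0_regular | exact: Sl0_max].
Qed.

Definition inverse_of x y := y * x = 1 /\ x * y = 1.

Definition invertible x := exists y, inverse_of x y.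

End Denominators.

Arguments regular : clear implicits.
Arguments Sl0 : clear implicits.
Arguments Sr0 : clear implicits.

Section Converse.
Variable R : pzRingType.

Lemma regularC : regular R^c = regular R.
Proof. by apply/seteqP; split=> x [? ?]; split. Qed.

Lemma left_denominatorC (S : set R) :
  left_denominator (R := R^c) S = right_denominator S.
Proof.
by apply/propext; split=> -[[S1 SM] ore rev];
  (split; first split) => // s t Ss St; apply: SM.
Qed.

Lemma Sl0C : Sl0 R^c = Sr0 R.
Proof.
apply/seteqP; split=> x [S [dS rS Sx]]; exists S; split=> //.
- by rewrite -left_denominatorC.
- by rewrite -regularC.
- by rewrite left_denominatorC.
- by rewrite regularC.
Qed.

Lemma Sr0_largest :
  [/\ right_denominator (Sr0 R), Sr0 R `<=` regular R
    & forall S, right_denominator S -> S `<=` regular R -> S `<=` Sr0 R].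
Proof.
have [dS rS maxS] := Sl0_largest R^c.
rewrite -Sl0C -regularC -left_denominatorC; split=> // S.
by rewrite -left_denominatorC; apply: maxS.
Qed.

End Converse.

(* An element q of Q_l(R) = S^-1 R, S = Sl0 R, is encoded by the graph
   {(x, y) in R x R | x q = y} of the right multiplication by q, i.e. by the
   set of all its representations as a fraction x^-1 y, where x is moreover
   allowed to be outside S.  By Q_l_embed_inj, Q_l_embed_invertible and
   Q_l_fraction below, this is the left localization of R at S. *)
Record Q_l (R : pzRingType) := QL {
  graph : R -> R -> Prop;
  graphD : forall x y x' y',
    graph x y -> graph x' y' -> graph (x + x') (y + y');
  graphM : forall a x y, graph x y -> graph (a * x) (a * y);
  graph_dom : exists s y, Sl0 R s /\ graph s y;
  graph_fun : forall y, graph 0 y -> y = 0;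
  graph_sat : forall s x y, Sl0 R s -> graph (s * x) (s * y) -> graph x y
}.

HB.instance Definition _ (R : pzRingType) := gen_eqMixin (Q_l R).
HB.instance Definition _ (R : pzRingType) := gen_choiceMixin (Q_l R).

Section LargestLeftQuotientRing.
Variable R : pzRingType.
Local Notation S := (Sl0 R).
Implicit Types (r s t x y z : R) (p q : Q_l R).

Let S1 : S 1. Proof. by have [[? ?] _ _] := Sl0_left_denominator R. Qed.

Let SM s t : S s -> S t -> S (s * t).
Proof. by have [[_ SM] _ _] := Sl0_left_denominator R; apply: SM. Qed.

Let ore s r : S s -> exists s' r', S s' /\ s' * r = r' * s.
Proof. by have [_ + _] := Sl0_left_denominator R; apply. Qed.

Lemma graph_inj q x y z : graph q x y -> graph q x z -> y = z.
Proof.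
move=> xy /(graphM (-1)); rewrite !mulN1r => /(graphD xy).
by rewrite subrr => /graph_fun/eqP; rewrite subr_eq0 => /eqP.
Qed.

Lemma graph_eq p q : graph p = graph q -> p = q.
Proof.
case: p q => [g ? ? ? ? ?] [h ? ? ? ? ?] /= gh; subst h.
by congr QL; apply: Prop_irrelevance.
Qed.

Lemma Q_l_eq p q s y : S s -> graph p s y -> graph q s y -> p = q.
Proof.
suff sub p' q' : S s -> graph p' s y -> graph q' s y ->
    forall x z, graph p' x z -> graph q' x z.
  move=> Ss ps qs; apply: graph_eq; apply/funext => x; apply/funext => z.
  by apply/propext; split; apply: sub.
move=> Ss ps qs x z xz; have [t [a [St e]]] := ore x Ss.
apply: (graph_sat St); have := graphM t xz; rewrite e => /graph_inj.
by move=> /(_ _ (graphM a ps)) ->; apply: graphM.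
Qed.

Lemma frac_ex s r : S s -> exists q, graph q s r.
Proof.
move=> Ss.
pose g x y := exists t a, [/\ S t, t * x = a * s & t * y = a * r].
have gD x y x' y' : g x y -> g x' y' -> g (x + x') (y + y').
  move=> [t [a [St ex ey]]] [t' [a' [St' ex' ey']]].
  have [u [b [Su e]]] := ore t St'.
  exists (u * t), (u * a + b * a'); split; first exact: SM.
    by rewrite mulrDr [in X in _ + X]e -!mulrA ex ex' !mulrA -mulrDl.
  by rewrite mulrDr [in X in _ + X]e -!mulrA ey ey' !mulrA -mulrDl.
have gM c x y : g x y -> g (c * x) (c * y).
  move=> [t [a [St ex ey]]]; have [u [b [Su e]]] := ore c St.
  exists u, (b * a); split=> //.
    by rewrite mulrA e -!mulrA ex.
  by rewrite mulrA e -!mulrA ey.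
have gsr : g s r by exists 1, 1; rewrite !mul1r.
have gdom : exists u y, S u /\ g u y by exists s, r.
have g0 y : g 0 y -> y = 0.
  move=> [t [a [St]]]; rewrite mulr0 => /esym.
  have [_ sr] := Sl0_regular Ss; move=> /sr ->; rewrite mul0r.
  by have [tl _] := Sl0_regular St; apply: tl.
have gsat u x y : S u -> g (u * x) (u * y) -> g x y.
  by move=> Su [t [a [St ex ey]]]; exists (t * u), a; rewrite -!mulrA; split;
    [exact: SM | |].
by exists (QL gD gM gdom g0 gsat).
Qed.

Lemma graph_lift q y : exists t z, S t /\ graph q (t * y) z.
Proof.
have [u [v [Su uv]]] := graph_dom q; have [t [a [St e]]] := ore y Su.
by exists t, (a * v); split=> //; rewrite e; apply: graphM.
Qed.

Lemma graph_lift2 p q x y :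
  exists t x' y', [/\ S t, graph p (t * x) x' & graph q (t * y) y'].
Proof.
have [t [x' [St px]]] := graph_lift p x.
have [u [y' [Su qy]]] := graph_lift q (t * y).
exists (u * t), (u * x'), y'; split; first exact: SM.
  by rewrite -mulrA; apply: graphM.
by rewrite -mulrA.
Qed.

Lemma graph_dom2 p q :
  exists s x y, [/\ S s, graph p s x & graph q s y].
Proof.
have [t [x [y [St px qy]]]] := graph_lift2 p q 1 1.
by exists t, x, y; split=> //; rewrite -[t]mulr1.
Qed.

Lemma Q_l_embed_ex r : exists q, graph q 1 r.
Proof. exact: frac_ex. Qed.

Lemma Q_l_opp_ex q : exists q', forall x y, graph q x y -> graph q' x (- y).
Proof.
have [s [r [Ss sr]]] := graph_dom q; have [q' q's] := frac_ex (- r) Ss.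
exists q' => x y xy; have [t [a [St e]]] := ore x Ss.
apply: (graph_sat St); rewrite e mulrN.
have -> : t * y = a * r.
  by apply: (@graph_inj q (t * x)); [|rewrite e]; apply: graphM.
by rewrite -mulrN; apply: graphM.
Qed.

Lemma Q_l_add_ex p q : exists q', forall x y z,
  graph p x y -> graph q x z -> graph q' x (y + z).
Proof.
have [s [y0 [z0 [Ss py qz]]]] := graph_dom2 p q.
have [q' q's] := frac_ex (y0 + z0) Ss.
exists q' => x y z xy xz; have [t [a [St e]]] := ore x Ss.
apply: (graph_sat St); rewrite e mulrDr.
have -> : t * y = a * y0.
  by apply: (@graph_inj p (t * x)); [|rewrite e]; apply: graphM.
have -> : t * z = a * z0.
  by apply: (@graph_inj q (t * x)); [|rewrite e]; apply: graphM.
by rewrite -mulrDr; apply: graphM.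
Qed.

Lemma Q_l_mul_ex p q : exists q', forall x y z,
  graph p x y -> graph q y z -> graph q' x z.
Proof.
have [s [y0 [Ss py]]] := graph_dom p; have [u [z0 [Su qz]]] := graph_lift q y0.
have [q' q's] := frac_ex z0 (SM Su Ss).
exists q' => x y z xy yz; have [t [a [St e]]] := ore x (SM Su Ss).
apply: (graph_sat St); rewrite e.
have ty : t * y = a * (u * y0).
  by apply: (@graph_inj p (t * x)); [|rewrite e]; do 2?apply: graphM.
have -> : t * z = a * z0.
  by apply: (@graph_inj q (t * y)); [|rewrite ty]; apply: graphM.
exact: graphM.
Qed.

Definition Q_l_embed r : Q_l R := sval (cid (Q_l_embed_ex r)).
Definition Q_l_opp q : Q_l R := sval (cid (Q_l_opp_ex q)).
Definition Q_l_add p q : Q_l R := sval (cid (Q_l_add_ex p q)).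
Definition Q_l_mul p q : Q_l R := sval (cid (Q_l_mul_ex p q)).

Lemma graph_embed r x : graph (Q_l_embed r) x (x * r).
Proof.
rewrite -{1}[x]mulr1; apply: graphM; exact: (svalP (cid (Q_l_embed_ex r))).
Qed.

Lemma graph_opp q x y : graph q x y -> graph (Q_l_opp q) x (- y).
Proof. exact: svalP (cid (Q_l_opp_ex q)) x y. Qed.

Lemma graph_add p q x y z :
  graph p x y -> graph q x z -> graph (Q_l_add p q) x (y + z).
Proof. exact: svalP (cid (Q_l_add_ex p q)) x y z. Qed.

Lemma graph_mul p q x y z :
  graph p x y -> graph q y z -> graph (Q_l_mul p q) x z.
Proof. exact: svalP (cid (Q_l_mul_ex p q)) x y z. Qed.

Lemma Q_l_addA : associative Q_l_add.
Proof.
move=> p q u; have [s [y [z [Ss py qz]]]] := graph_dom2 p q.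
have [t [w [St uw]]] := graph_lift u s.
have {}py := graphM t py; have {}qz := graphM t qz.
apply: (Q_l_eq (SM St Ss) (graph_add py (graph_add qz uw))).
by rewrite addrA; do 2?apply: graph_add.
Qed.

Lemma Q_l_addC : commutative Q_l_add.
Proof.
move=> p q; have [s [y [z [Ss py qz]]]] := graph_dom2 p q.
by apply: (Q_l_eq Ss (graph_add py qz)); rewrite addrC; apply: graph_add.
Qed.

Lemma Q_l_add0 : left_id (Q_l_embed 0) Q_l_add.
Proof.
move=> q; have [s [y [Ss qy]]] := graph_dom q.
by apply: (Q_l_eq Ss (graph_add (graph_embed 0 s) qy)); rewrite mulr0 add0r.
Qed.

Lemma Q_l_addN : left_inverse (Q_l_embed 0) Q_l_opp Q_l_add.
Proof.
move=> q; have [s [y [Ss qy]]] := graph_dom q.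
apply: (Q_l_eq Ss (graph_add (graph_opp qy) qy)); rewrite addNr.
by rewrite -[X in graph _ s X](mulr0 s); apply: graph_embed.
Qed.

Lemma Q_l_mulA : associative Q_l_mul.
Proof.
move=> p q u; have [s [y [Ss py]]] := graph_dom p.
have [t [z [St qz]]] := graph_lift q y; have [v [w [Sv uw]]] := graph_lift u z.
have {}py := graphM v (graphM t py); have {}qz := graphM v qz.
apply: (Q_l_eq (SM Sv (SM St Ss)) (graph_mul py (graph_mul qz uw))).
exact: graph_mul (graph_mul py qz) uw.
Qed.

Lemma Q_l_mul1r : left_id (Q_l_embed 1) Q_l_mul.
Proof.
move=> q; have [s [y [Ss qy]]] := graph_dom q.
apply: (Q_l_eq Ss _ qy); apply: (graph_mul (graph_embed 1 s)).
by rewrite mulr1.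
Qed.

Lemma Q_l_mulr1 : right_id (Q_l_embed 1) Q_l_mul.
Proof.
move=> q; have [s [y [Ss qy]]] := graph_dom q.
apply: (Q_l_eq Ss _ qy); apply: (graph_mul qy).
by rewrite -{2}[y]mulr1; apply: graph_embed.
Qed.

Lemma Q_l_mulDl : left_distributive Q_l_mul Q_l_add.
Proof.
move=> p q u; have [s [y [z [Ss py qz]]]] := graph_dom2 p q.
have [t [v [w [St uv uw]]]] := graph_lift2 u u y z.
have {}py := graphM t py; have {}qz := graphM t qz.
apply: (Q_l_eq (SM St Ss) (graph_mul (graph_add py qz) (graphD uv uw))).
by apply: graph_add; [apply: graph_mul py uv | apply: graph_mul qz uw].
Qed.

Lemma Q_l_mulDr : right_distributive Q_l_mul Q_l_add.
Proof.
move=> p q u; have [s [y [Ss py]]] := graph_dom p.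
have [t [v [w [St qv uw]]]] := graph_lift2 q u y y.
have {}py := graphM t py.
apply: (Q_l_eq (SM St Ss) (graph_mul py (graph_add qv uw))).
by apply: graph_add; [apply: graph_mul py qv | apply: graph_mul py uw].
Qed.

HB.instance Definition _ := @GRing.isPzRing.Build (Q_l R)
  (Q_l_embed 0) Q_l_opp Q_l_add (Q_l_embed 1) Q_l_mul
  Q_l_addA Q_l_addC Q_l_add0 Q_l_addN
  Q_l_mulA Q_l_mul1r Q_l_mulr1 Q_l_mulDl Q_l_mulDr.

Lemma Q_l_embed_zmod_morphism : zmod_morphism Q_l_embed.
Proof.
move=> x y; apply: (Q_l_eq S1 (graph_embed (x - y) 1)); rewrite mulrBr.
apply: graph_add; [exact: graph_embed | apply: graph_opp].
exact: graph_embed.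
Qed.

Lemma Q_l_embed_monoid_morphism : monoid_morphism Q_l_embed.
Proof.
split=> // x y; apply: (Q_l_eq S1 (graph_embed (x * y) 1)); rewrite mulrA.
by apply: graph_mul; apply: graph_embed.
Qed.

HB.instance Definition _ :=
  GRing.isZmodMorphism.Build R (Q_l R) Q_l_embed Q_l_embed_zmod_morphism.
HB.instance Definition _ :=
  GRing.isMonoidMorphism.Build R (Q_l R) Q_l_embed Q_l_embed_monoid_morphism.

Lemma Q_l_embed_inj : injective Q_l_embed.
Proof.
move=> x y e; have := graph_embed x 1; rewrite e !mul1r => /graph_inj.
by apply; rewrite -{2}[y]mul1r; apply: graph_embed.
Qed.

Lemma Q_l_embed_invertible s : S s -> invertible (Q_l_embed s).
Proof.
move=> Ss; have [q qs] := frac_ex 1 Ss; exists q.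
have g1 : graph (Q_l_embed 1) s s by rewrite -{2}[s]mulr1; apply: graph_embed.
split.
  apply: (Q_l_eq Ss _ g1); apply: (graph_mul qs).
  by rewrite -{2}[s]mul1r; apply: graph_embed.
apply: (Q_l_eq S1 _ (graph_embed 1 1)); rewrite mulr1.
by apply: (graph_mul (graph_embed s 1)); rewrite mul1r.
Qed.

Lemma Q_l_fraction q : exists s r (s' : Q_l R), [/\ S s,
  inverse_of (Q_l_embed s) s' & q = s' * Q_l_embed r].
Proof.
have [s [r [Ss qr]]] := graph_dom q.
have [s' [e1 e2]] := Q_l_embed_invertible Ss.
exists s, r, s'; split=> //.
have <- : Q_l_embed s * q = Q_l_embed r.
  apply: (Q_l_eq S1 _ (graph_embed r 1)).
  by apply: (graph_mul (graph_embed s 1)); rewrite !mul1r.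
by rewrite mulrA e1 mul1r.
Qed.

End LargestLeftQuotientRing.

(* The right-handed version over R is the left-handed one over the opposite
   ring; recall that Sl0 R^c = Sr0 R by Sl0C. *)
Definition Q_r (R : pzRingType) : Type := (Q_l R^c)^c.

HB.instance Definition _ (R : pzRingType) := GRing.PzRing.on (Q_r R).

Definition Q_r_embed (R : pzRingType) (r : R) : Q_r R := @Q_l_embed R^c r.

Section LargestRightQuotientRing.
Variable R : pzRingType.

Lemma Q_r_embed_zmod_morphism : zmod_morphism (@Q_r_embed R).
Proof. exact: (@Q_l_embed_zmod_morphism R^c). Qed.

Lemma Q_r_embed_monoid_morphism : monoid_morphism (@Q_r_embed R).
Proof.
have [e1 eM] := @Q_l_embed_monoid_morphism R^c.
by split=> // x y; apply: (eM y x).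
Qed.

HB.instance Definition _ :=
  GRing.isZmodMorphism.Build R (Q_r R) (@Q_r_embed R) Q_r_embed_zmod_morphism.
HB.instance Definition _ :=
  GRing.isMonoidMorphism.Build R (Q_r R) (@Q_r_embed R)
    Q_r_embed_monoid_morphism.

Lemma Q_r_embed_inj : injective (@Q_r_embed R).
Proof. exact: (@Q_l_embed_inj R^c). Qed.

Lemma Q_r_embed_invertible (s : R) : Sr0 R s -> invertible (Q_r_embed s).
Proof.
by rewrite -Sl0C => /Q_l_embed_invertible[q [e1 e2]]; exists q; split.
Qed.

Lemma Q_r_fraction (q : Q_r R) : exists s r s', [/\ Sr0 R s,
  inverse_of (Q_r_embed s) s' & q = Q_r_embed r * s'].
Proof.
have [s [r [s' [Ss [e1 e2] e]]]] := @Q_l_fraction R^c q.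
by exists s, r, s'; rewrite -Sl0C; do 2?split.
Qed.

End LargestRightQuotientRing.

Section Orders.
Variable Q : pzRingType.
Implicit Types S T : set Q.

(* Subrings need not contain 1. *)
Definition is_subring S :=
  [/\ S 0, forall x y, S x -> S y -> S (x - y)
    & forall x y, S x -> S y -> S (x * y)].

Definition left_order S :=
  is_subring S /\ forall q, exists r s s',
    [/\ S r, S s, inverse_of s s' & q = s' * r].

Definition right_order S :=
  is_subring S /\ forall q, exists r s s',
    [/\ S r, S s, inverse_of s s' & q = r * s'].

Definition order_equiv S T :=
  (exists a b, [/\ invertible a, invertible b &
     [set a * x * b | x in S] `<=` T]) /\
  (exists a b, [/\ invertible a, invertible b &
     [set a * x * b | x in T] `<=` S]).

Definition maximal_left_order S :=
  left_order S /\
  forall T, left_order T -> order_equiv S T -> S `<=` T -> T = S.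

Definition maximal_right_order S :=
  right_order S /\
  forall T, right_order T -> order_equiv S T -> S `<=` T -> T = S.

End Orders.

Section PolynomialEndomorphisms.
Variables (K : fieldType) (n : nat).

Definition poly_end : Type := {linear {mpoly K[n]} -> {mpoly K[n]}}.

HB.instance Definition _ := gen_eqMixin poly_end.
HB.instance Definition _ := gen_choiceMixin poly_end.

Implicit Types f g h : poly_end.

Lemma poly_endP f g : (f : _ -> _) =1 (g : _ -> _) -> f = g.
Proof.
case: f g => [f cf] [g cg] /= /funext fg; subst g; congr GRing.Linear.Pack.
case: cf cg => [[a] [b]] [[c] [d]].
by rewrite (Prop_irrelevance a c) (Prop_irrelevance b d).
Qed.

Definition end_zero : poly_end := \0.
Definition end_opp f : poly_end := \- f.
Definition end_add f g : poly_end := f \+ g.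
Definition end_one : poly_end := idfun.
Definition end_mul f g : poly_end := f \o g.
Definition end_scale (a : K) f : poly_end := a \*: f.

Lemma end_addA : associative end_add.
Proof. by move=> f g h; apply: poly_endP => p /=; rewrite addrA. Qed.

Lemma end_addC : commutative end_add.
Proof. by move=> f g; apply: poly_endP => p /=; rewrite addrC. Qed.

Lemma end_add0 : left_id end_zero end_add.
Proof. by move=> f; apply: poly_endP => p /=; rewrite add0r. Qed.

Lemma end_addN : left_inverse end_zero end_opp end_add.
Proof. by move=> f; apply: poly_endP => p /=; rewrite addNr. Qed.

Lemma end_mulA : associative end_mul.
Proof. by move=> f g h; apply: poly_endP. Qed.

Lemma end_mul1 : left_id end_one end_mul.
Proof. by move=> f; apply: poly_endP. Qed.

Lemma end_mulr1 : right_id end_one end_mul.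
Proof. by move=> f; apply: poly_endP. Qed.

Lemma end_mulDl : left_distributive end_mul end_add.
Proof. by move=> f g h; apply: poly_endP. Qed.

Lemma end_mulDr : right_distributive end_mul end_add.
Proof. by move=> f g h; apply: poly_endP => p /=; rewrite linearD. Qed.

Lemma end_one_neq0 : end_one != end_zero.
Proof.
apply/eqP => /(congr1 (fun f : poly_end => f 1)) /= /eqP.
by rewrite oner_eq0.
Qed.

HB.instance Definition _ := @GRing.isNzRing.Build poly_end
  end_zero end_opp end_add end_one end_mul end_addA end_addC end_add0 end_addN
  end_mulA end_mul1 end_mulr1 end_mulDl end_mulDr end_one_neq0.

Lemma end_scaleA a b f : end_scale a (end_scale b f) = end_scale (a * b) f.
Proof. by apply: poly_endP => p /=; rewrite scalerA. Qed.

Lemma end_scale1 : left_id 1 end_scale.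
Proof. by move=> f; apply: poly_endP => p /=; rewrite scale1r. Qed.

Lemma end_scaleDr : right_distributive end_scale +%R.
Proof. by move=> a f g; apply: poly_endP => p /=; rewrite scalerDr. Qed.

Lemma end_scaleDl f : {morph end_scale^~ f : a b / a + b}.
Proof. by move=> a b; apply: poly_endP => p /=; rewrite scalerDl. Qed.

HB.instance Definition _ := GRing.Zmodule_isLmodule.Build K poly_end
  end_scaleA end_scale1 end_scaleDr end_scaleDl.

Lemma end_scaleAl (a : K) (f g : poly_end) : a *: (f * g) = (a *: f) * g.
Proof. exact: poly_endP. Qed.

HB.instance Definition _ :=
  GRing.Lmodule_isLalgebra.Build K poly_end end_scaleAl.

Lemma end_scaleAr (a : K) (f g : poly_end) : a *: (f * g) = f * (a *: g).
Proof. by apply: poly_endP => p /=; rewrite linearZ. Qed.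

HB.instance Definition _ :=
  GRing.Lalgebra_isAlgebra.Build K poly_end end_scaleAr.

Definition mul_var (i : 'I_n) (p : {mpoly K[n]}) : {mpoly K[n]} := 'X_i * p.

Definition integration (i : 'I_n) (p : {mpoly K[n]}) : {mpoly K[n]} :=
  \sum_(m <- msupp p) (p@_m / (m i).+1%:R) *: ('X_i * 'X_[m]).

Lemma mul_var_is_linear i : linear (mul_var i).
Proof. by move=> a p q; rewrite /mul_var mulrDr scalerAr. Qed.

HB.instance Definition _ i :=
  GRing.isLinear.Build K {mpoly K[n]} {mpoly K[n]} _ (mul_var i)
    (mul_var_is_linear i).

Lemma integration_wide i (d : nat) p : (msize p <= d)%N -> integration i p =
  \sum_(m : 'X_{1..n < d}) (p@_m / (m i).+1%:R) *: ('X_i * 'X_[m]).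
Proof.
move=> le_pd; pose I : subFinType _ := 'X_{1..n < d}.
rewrite /integration (big_mksub I) /=; first last.
- by move=> m /msize_mdeg_lt /leq_trans; apply.
- exact: msupp_uniq.
rewrite big_rmcond //= => m /memN_msupp_eq0 ->.
by rewrite mul0r scale0r.
Qed.

Lemma integration_is_linear i : linear (integration i).
Proof.
move=> a p q; pose d := maxn (msize (a *: p + q)) (maxn (msize p) (msize q)).
rewrite !(@integration_wide i d) ?leq_max ?leqnn ?orbT //.
rewrite scaler_sumr -big_split /=; apply: eq_bigr => m _.
by rewrite mcoeffD mcoeffZ mulrDl scalerDl scalerA mulrA.
Qed.

HB.instance Definition _ i :=
  GRing.isLinear.Build K {mpoly K[n]} {mpoly K[n]} _ (integration i)
    (integration_is_linear i).

Lemma integrationX i m :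
  integration i 'X_[m] = (m i).+1%:R^-1 *: ('X_i * 'X_[m]).
Proof. by rewrite /integration msuppX big_seq1 mcoeffX eqxx mul1r. Qed.

Definition I_generator : set poly_end :=
  [set f | exists i : 'I_n, [\/ f = mul_var i :> poly_end,
     f = mderiv i :> poly_end | f = integration i :> poly_end]].

Definition in_I : {pred poly_end} := fun f =>
  `[< forall A : {pred poly_end}, GRing.subalg_closed A ->
        (forall g, I_generator g -> g \in A) -> f \in A >].

Lemma in_I_subalg : GRing.subalg_closed in_I.
Proof.
split.
- by apply/asboolP => A [].
- move=> a f g /asboolP If /asboolP Ig; apply/asboolP => A Acl GA.
  by have [_ lin _] := Acl; apply: lin; [apply: If | apply: Ig].
- move=> f g /asboolP If /asboolP Ig; apply/asboolP => A Acl GA.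
  by have [_ _ mul] := Acl; apply: mul; [apply: If | apply: Ig].
Qed.

Lemma I_generator_in f : I_generator f -> f \in in_I.
Proof. by move=> Gf; apply/asboolP => A _; apply. Qed.

HB.instance Definition _ := GRing.isSubalgClosed.Build K poly_end in_I
  (GRing.subalg_closed_semi in_I_subalg).

End PolynomialEndomorphisms.

Record I_alg (K : fieldType) (n : nat) := IAlg {
  I_val : poly_end K n;
  I_valP : in_I I_val
}.

HB.instance Definition _ K n := [isSub for @I_val K n].
HB.instance Definition _ K n := [Choice of I_alg K n by <:].
HB.instance Definition _ K n := [SubChoice_isSubAlgebra of I_alg K n by <:].

(* Main.v *)
Require Import Defs.
From mathcomp Require Import all_boot all_order all_algebra.
From mathcomp Require Import boolp classical_sets mpoly.

Local Open Scope ring_scope.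
Local Open Scope classical_set_scope.

Set Implicit Arguments.
Unset Strict Implicit.
Unset Printing Implicit Defensive.

Import GRing.Theory.

(** Write R for the algebra, X_i, D_i, J_i for its generators (multiplication by
    x_i, i-th derivation, i-th integration), and Q for either of the two
    quotient rings.

    The theorem reduces to a simplicity property of R: a two-sided ideal
    containing an element that is not a left zero divisor contains 1.  Indeed,
    let T be an order of Q containing R with a T b <= R for units a, b of Q.
    Clearing denominators, which lie in R and hence in T, gives r T c <= R for
    some r, c in R that are units of Q.  The elements u of R with r T u <= R
    form a two-sided ideal of R, since T R <= T, and it contains c; so it
    contains 1, and r T <= R.  Likewise the elements u with u T <= R form a
    two-sided ideal containing r, so T <= R ([overring_sub]).

    For the simplicity property, let A be an ideal of R and c in A with no right
    annihilator.  The relations D_i J_i = 1 and X_i J_i = J_i (X_i + J_i) make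
    conjugation w |-> D_i w J_i tame on the algebra generated by the X_i and
    J_i: there, the difference w |-> D_i w J_i - w is locally nilpotent
    ([int_nilpotent]).  Multiplying an element of R on the right by enough J_i
    moves it into the operators with this property ([in_I_int_nilpotent]), and
    it does not kill c.  So A contains a nonzero operator w of this kind;
    applying the differences, which preserve A, as long as the result is
    nonzero, one reaches a nonzero w in A that commutes with every J_i
    ([ideal_commuting]).

    Such a w is determined by the polynomial w 1, because the monomials are
    multiples of products of the J_i applied to 1; in other words w is a
    polynomial in the J_i.  Now [X_i D_i, J_i] = J_i, so that
    w |-> D_i [X_i D_i, w] is the partial derivative of w with respect to J_i.
    It preserves A, and in characteristic zero iterating it leads to a nonzero
    scalar ([ideal_one]). *)

(** * Overrings equivalent to a ring without proper regular ideals *)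

Definition two_sided_ideal {R : pzRingType} (A : set R) :=
  [/\ forall x y, A x -> A y -> A (x - y),
      forall r x, A x -> A (r * x)
    & forall r x, A x -> A (x * r)].

Definition left_cancellable {R : pzRingType} (c : R) :=
  forall x, c * x = 0 -> x = 0.

Definition regular_ideals_trivial (R : pzRingType) :=
  forall (A : set R) c, two_sided_ideal A -> A c -> left_cancellable c -> A 1.

Lemma range_is_subring (R Q : pzRingType) (f : {rmorphism R -> Q}) :
  is_subring (range f).
Proof.
split=> [|_ _ [a _ <-] [b _ <-]|_ _ [a _ <-] [b _ <-]].
- by exists 0; rewrite ?rmorph0.
- by exists (a - b); rewrite ?rmorphB.
- by exists (a * b); rewrite ?rmorphM.
Qed.

Section Overring.
Variables (R Q : pzRingType) (f : {rmorphism R -> Q}).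

Lemma left_cancellable_invertible c :
  injective f -> invertible (f c) -> left_cancellable c.
Proof.
move=> f_inj [y [yc _]] x cx0; apply: f_inj.
by rewrite raddf0 -[LHS]mul1r -yc -mulrA -rmorphM cx0 raddf0 mulr0.
Qed.

(** Both steps use the same device: since T absorbs R, the multipliers in R that
    bring r T (resp. T) into R form a two-sided ideal of R, to which the
    hypothesis on ideals applies. *)
Lemma overring_sub (T : set Q) r c : regular_ideals_trivial R ->
  is_subring T -> range f `<=` T -> left_cancellable r -> left_cancellable c ->
  (forall t, T t -> range f (f r * t * f c)) -> T `<=` range f.
Proof.
move=> simpleR [_ _ TM] RT regr regc rTc.
have T_f a : T (f a) by apply: RT; exists a.
have [_ rangeB rangeM] := range_is_subring f.
have range_f a : range f (f a) by exists a.
have rT t : T t -> range f (f r * t).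
  pose A : set R := [set a | forall t, T t -> range f (f r * t * f a)].
  suff A1 : A 1 by move=> Tt; have := A1 _ Tt; rewrite rmorph1 mulr1.
  apply: (simpleR A c) => //;
    split=> [x y Ax Ay t' Tt'|b x Ax t' Tt'|b x Ax t' Tt'].
  - by rewrite rmorphB mulrBr; apply: rangeB; [apply: Ax | apply: Ay].
  - by rewrite rmorphM mulrA -(mulrA (f r)); apply: Ax; apply: TM.
  - by rewrite rmorphM mulrA; apply: rangeM => //; apply: Ax.
pose A : set R := [set a | forall t, T t -> range f (f a * t)].
suff A1 : A 1 by move=> t Tt; have := A1 _ Tt; rewrite rmorph1 mul1r.
apply: (simpleR A r) => //;
  split=> [x y Ax Ay t' Tt'|b x Ax t' Tt'|b x Ax t' Tt'].
- by rewrite rmorphB mulrBl; apply: rangeB; [apply: Ax | apply: Ay].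
- by rewrite rmorphM -mulrA; apply: rangeM => //; apply: Ax.
- by rewrite rmorphM -mulrA; apply: Ax; apply: TM.
Qed.

End Overring.

Lemma invertibleM (Q : pzRingType) (a b : Q) :
  invertible a -> invertible b -> invertible (a * b).
Proof.
move=> [x [xa ax]] [y [yb by_]]; exists (y * x); split.
  by rewrite mulrA -(mulrA y) xa mulr1 yb.
by rewrite mulrA -(mulrA a) by_ mulr1 ax.
Qed.

Lemma maximal_left_order_Q_l (R : pzRingType) :
  regular_ideals_trivial R -> maximal_left_order (range (@Q_l_embed R)).
Proof.
move=> simpleR; have embed_inj := @Q_l_embed_inj R.
have clear_denom (q : Q_l R) : invertible q -> exists s r,
    [/\ invertible (Q_l_embed s), invertible (Q_l_embed r)
      & Q_l_embed s * q = Q_l_embed r].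
  move=> inv_q; have [s [r [s' [_ [s's ss'] q_sr]]]] := Q_l_fraction q.
  have sq : Q_l_embed s * q = Q_l_embed r by rewrite q_sr mulrA ss' mul1r.
  have inv_s : invertible (Q_l_embed s) by exists s'.
  by exists s, r; split=> //; rewrite -sq; apply: invertibleM.
split.
  split=> [|q]; first exact: range_is_subring.
  have [s [r [s' [_ inv_s q_sr]]]] := Q_l_fraction q.
  by exists (Q_l_embed r), (Q_l_embed s), s'; split.
move=> T [Tring _] [_ [a [b [inv_a inv_b aTb]]]] RT.
apply/seteqP; split=> //.
have [s [r [_ inv_r sa]]] := clear_denom a inv_a.
have [s2 [c [_ inv_c s2b]]] := clear_denom b inv_b.
apply: (overring_sub (r := r) (c := c)) => //.
- exact: (left_cancellable_invertible (f := @Q_l_embed R) embed_inj inv_r).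
- exact: (left_cancellable_invertible (f := @Q_l_embed R) embed_inj inv_c).
move=> t Tt; rewrite /= -sa -s2b.
have [_ _ TM] := Tring.
(* The denominator s2 of b, being in R, is absorbed by T, and s clears a. *)
have [|u _ u_eq] := aTb (a * (t * Q_l_embed s2) * b).
  by exists (t * Q_l_embed s2) => //; apply: TM => //; apply: RT; exists s2.
by exists (s * u) => //; rewrite rmorphM /= u_eq !mulrA.
Qed.

Lemma maximal_right_order_Q_r (R : pzRingType) :
  regular_ideals_trivial R -> maximal_right_order (range (@Q_r_embed R)).
Proof.
move=> simpleR; have embed_inj := @Q_r_embed_inj R.
have clear_denom (q : Q_r R) : invertible q -> exists s r,
    [/\ invertible (Q_r_embed s), invertible (Q_r_embed r)
      & q * Q_r_embed s = Q_r_embed r].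
  move=> inv_q; have [s [r [s' [_ [s's ss'] q_rs]]]] := Q_r_fraction q.
  have qs : q * Q_r_embed s = Q_r_embed r by rewrite q_rs -mulrA s's mulr1.
  have inv_s : invertible (Q_r_embed s) by exists s'.
  by exists s, r; split=> //; rewrite -qs; apply: invertibleM.
split.
  split=> [|q]; first exact: range_is_subring.
  have [s [r [s' [_ inv_s q_rs]]]] := Q_r_fraction q.
  by exists (Q_r_embed r), (Q_r_embed s), s'; split.
move=> T [Tring _] [_ [a [b [inv_a inv_b aTb]]]] RT.
apply/seteqP; split=> //.
have [s [r [_ inv_r as_]]] := clear_denom a inv_a.
have [s2 [c [_ inv_c bs2]]] := clear_denom b inv_b.
apply: (overring_sub (r := r) (c := c)) => //.
- exact: (left_cancellable_invertible (f := @Q_r_embed R) embed_inj inv_r).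
- exact: (left_cancellable_invertible (f := @Q_r_embed R) embed_inj inv_c).
move=> t Tt; rewrite /= -as_ -bs2.
have [_ _ TM] := Tring.
(* The denominator s of a, being in R, is absorbed by T, and s2 clears b. *)
have [|u _ u_eq] := aTb (a * (Q_r_embed s * t) * b).
  by exists (Q_r_embed s * t) => //; apply: TM => //; apply: RT; exists s.
by exists (u * s2) => //; rewrite rmorphM /= u_eq !mulrA.
Qed.

(** * Relations between multiplications, derivations and integrations *)

(** With d, x, j the operators D_i, X_i, J_i, the element x d is the Euler
    operator, with (x d) j = j (x d + 1), so the commutator of x d with a
    w commuting with j commutes with j.  Moreover j d is a projection acting as
    the identity on every multiple j y; both terms of the commutator are of this
    form, so that composing with d preserves commutation with j. *)
Lemma commutator_commutes (S : pzRingType) (d x j w : S) :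
    d * j = 1 -> j * (d * x) = x -> d * x = x * d + 1 -> w * j = j * w ->
  let e := d * (x * d * w - w * (x * d)) in e * j = j * e.
Proof.
move=> dj jdx dx wj /=; set c := _ - _.
have xj : x * d * j = j * (x * d + 1) by rewrite -mulrA dj mulr1 -dx jdx.
have cj : c * j = j * c.
  rewrite mulrBl mulrBr -(mulrA (x * d) w j) wj (mulrA (x * d) j w) xj.
  rewrite -(mulrA w (x * d) j) xj (mulrA w j) wj.
  rewrite !mulrDr mulrDl !mulr1 !mulrA.
  by rewrite opprD addrACA subrr addr0.
rewrite -mulrA cj mulrA dj mul1r.
have xd : x * d = j * (d * (x * d)) by rewrite -{1}jdx !mulrA.
rewrite /c !mulrBr; congr (_ - _).
  by rewrite {1}xd !mulrA.
by rewrite xd (mulrA w j) wj -!mulrA (mulrA d j) dj mul1r.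
Qed.

Section Relations.
Variables (K : fieldType) (n : nat).
Hypothesis char0 : [pchar K] =i pred0.
Local Notation E := (poly_end K n).
Local Notation X i := (mul_var i : E).
Local Notation D i := (mderiv i : E).
Local Notation J i := (integration i : E).
Implicit Types (f g w : E) (i j : 'I_n).

Let natr_neq0 k : k.+1%:R != 0 :> K.
Proof.
rewrite natf_neq0_pchar; apply/pnatP => // p _ _.
by move: (char0 p); rewrite !inE => ->.
Qed.

Lemma poly_end_eq_monomials f g :
  (forall m, f 'X_[m] = g 'X_[m]) -> f = g.
Proof.
move=> fg; apply: poly_endP => p; rewrite (mpolyE p) !linear_sum.
by apply: eq_bigr => m _; rewrite !linearZ fg.
Qed.

Lemma mderiv_integration i : D i * J i = 1.
Proof.
apply: poly_end_eq_monomials => m; rewrite /GRing.mul /=.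
rewrite integrationX linearZ /= -mpolyXD mderivX scalerA.
by rewrite mnmDE mnm1E eqxx add1n mulVf // scale1r addmC addmK.
Qed.

Lemma mderiv_mul_var i : D i * X i = X i * D i + 1.
Proof.
apply: poly_endP => p; rewrite /GRing.mul /GRing.add /= /end_one /mul_var /=.
rewrite mderivM mderivX mnm1E eqxx -{1}[U_(i)%MM]add0m addmK.
by rewrite mpolyX0 scale1r mul1r addrC.
Qed.

Lemma integration_mderiv_mul_var i : J i * (D i * X i) = X i.
Proof.
apply: poly_end_eq_monomials => m; rewrite /GRing.mul /= /mul_var.
rewrite -mpolyXD mderivX linearZ /= integrationX scalerA.
rewrite mnmDE mnm1E eqxx add1n (addmC U_(i)%MM m) addmK.
by rewrite mulfV // scale1r -mpolyXD addmC.
Qed.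

Lemma integrationC i j : J i * J j = J j * J i.
Proof.
have [-> //|ij] := eqVneq i j.
apply: poly_end_eq_monomials => m; rewrite /GRing.mul /=.
rewrite !integrationX !linearZ /= -!mpolyXD !integrationX !scalerA.
rewrite !mnmDE !mnm1E (eq_sym j i) (negbTE ij) !add0n mulrC.
by rewrite -!mpolyXD !addmA (addmC U_(i)%MM).
Qed.

Lemma integration_mul_varC i j : i != j -> X i * J j = J j * X i.
Proof.
move=> ij; apply: poly_end_eq_monomials => m; rewrite /GRing.mul /= /mul_var.
rewrite !integrationX -!mpolyXD !integrationX -scalerAr.
by rewrite mnmDE mnm1E (negbTE ij) add0n -!mpolyXD !addmA (addmC U_(i)%MM).
Qed.

Lemma mderiv_integrationC i j : i != j -> D i * J j = J j * D i.
Proof.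
move=> ij; apply: poly_end_eq_monomials => m; rewrite /GRing.mul /=.
rewrite integrationX !linearZ /= -mpolyXD !mderivX.
rewrite [integration j _]linearZ /= integrationX.
rewrite !scalerA mnmDE mnmBE !mnm1E (eq_sym j i) (negbTE ij) add0n subn0.
rewrite mulrC -mpolyXD; have [mi0|mi0] := eqVneq (m i) 0%N.
  by rewrite mi0 !mul0r !scale0r.
congr (_ *: 'X_[_]); apply/mnmP => k; rewrite !(mnmDE, mnmBE, mnm1E).
have [<-|ik] := eqVneq i k; last by rewrite !subn0.
by rewrite (eq_sym j i) (negbTE ij) !add0n.
Qed.

(** Conjugating X_i by J_i adds J_i, which itself commutes with J_i: this is why
    two differences suffice to kill X_i. *)
Lemma mul_var_integration i : X i * J i = J i * (X i + J i).
Proof.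
rewrite -{1}(integration_mderiv_mul_var i) mderiv_mul_var -!mulrA.
by rewrite !(mulrDl, mulrDr) mul1r -mulrA mderiv_integration mulr1.
Qed.

(** * Operators on which conjugation by integrations is unipotent *)

(** As J_i is left invertible, the v below can only be D_i w J_i - w, so the
    predicate says that any k successive such differences annihilate w.  Moving
    J_i to the left past w, rather than conjugating by D_i and J_i, is stronger:
    it makes w |-> w + v multiplicative, which a mere conjugation is not because
    J_i D_i is not 1. *)
Fixpoint int_nil k w : Prop :=
  if k is k'.+1 then forall i, exists2 v, int_nil k' v & w * J i = J i * (w + v)
  else w = 0.

Lemma int_nil0 k : int_nil k 0.
Proof.
by elim: k => // k IH i; exists 0; rewrite // mul0r addr0 mulr0.
Qed.

Lemma int_nilS k w : int_nil k w -> int_nil k.+1 w.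
Proof.
elim: k w => [w ->|k IH w wk i]; first exact: int_nil0 1%N.
by have [v /IH vk e] := wk i; exists v.
Qed.

Lemma int_nil_leq k l w : (k <= l)%N -> int_nil k w -> int_nil l w.
Proof. by move=> /subnK<- wk; elim: (l - k)%N => //= m; apply: int_nilS. Qed.

Lemma int_nilD k f g : int_nil k f -> int_nil k g -> int_nil k (f + g).
Proof.
elim: k f g => [f g -> ->|k IH f g fk gk i]; first exact: addr0.
have [u uk ef] := fk i; have [v vk eg] := gk i.
by exists (u + v); [apply: IH | rewrite mulrDl ef eg -mulrDr addrACA].
Qed.

Lemma int_nilZ k (a : K) f : int_nil k f -> int_nil k (a *: f).
Proof.
elim: k f => [f ->|k IH f fk i]; first exact: scaler0.
have [u uk ef] := fk i; exists (a *: u); first exact: IH.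
by rewrite -scalerAl ef -scalerDr scalerAr.
Qed.

(** The differences satisfy the Leibniz rule of a skew derivation: if the
    differences of f and g are u and v, that of f g is f v + u g + u v. *)
Lemma int_nilM k l f g : int_nil k f -> int_nil l g -> int_nil (k + l) (f * g).
Proof.
elim: k l f g => [l f g -> _|k IHk l f g fk].
  by rewrite mul0r; apply: int_nil0.
elim: l g => [g ->|l IHl g gl]; first by rewrite mulr0; apply: int_nil0.
rewrite addSn => i.
have [u uk ef] := fk i; have [v vl eg] := gl i.
exists (f * v + u * g + u * v); last first.
  rewrite -mulrA eg mulrA ef -mulrA; congr (_ * _).
  by rewrite mulrDl !mulrDr -!addrA.
apply: int_nilD; first apply: int_nilD.
- by rewrite plusE -addSnnS; apply: IHl.
- exact: IHk.
- by apply: (@int_nil_leq (k + l)); [rewrite plusE leq_add2l | apply: IHk].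
Qed.

Definition int_nilpotent w := exists k, int_nil k w.

Lemma int_nilpotentD f g :
  int_nilpotent f -> int_nilpotent g -> int_nilpotent (f + g).
Proof.
move=> [k fk] [l gl]; exists (maxn k l); apply: int_nilD.
  by apply: int_nil_leq fk; apply: leq_maxl.
by apply: int_nil_leq gl; apply: leq_maxr.
Qed.

Lemma int_nilpotentZ (a : K) f : int_nilpotent f -> int_nilpotent (a *: f).
Proof. by move=> [k fk]; exists k; apply: int_nilZ. Qed.

Lemma int_nilpotentM f g :
  int_nilpotent f -> int_nilpotent g -> int_nilpotent (f * g).
Proof. by move=> [k fk] [l gl]; exists (k + l)%N; apply: int_nilM. Qed.

Lemma int_nilpotent1 : int_nilpotent 1.
Proof. by exists 1%N => i; exists 0; rewrite // addr0 mulr1 mul1r. Qed.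

Lemma int_nilpotent_integration j : int_nilpotent (J j).
Proof. by exists 1%N => i; exists 0; rewrite // addr0 integrationC. Qed.

Lemma int_nilpotent_mul_var j : int_nilpotent (X j).
Proof.
exists 2%N => i; have [<-|ij] := eqVneq j i.
  exists (J j); last exact: mul_var_integration.
  by move=> i'; exists 0; rewrite // addr0 integrationC.
by exists 0; rewrite ?addr0 ?integration_mul_varC //; apply: int_nil0 1%N.
Qed.

Definition int_prod (s : seq 'I_n) : E := \prod_(i <- s) J i.

Lemma int_prod_cat s t : int_prod (s ++ t) = int_prod s * int_prod t.
Proof. exact: big_cat. Qed.

Lemma int_prodC s t : int_prod s * int_prod t = int_prod t * int_prod s.
Proof.
apply: commr_prod => i _; apply/commr_sym; apply: commr_prod => j _.
exact: integrationC.
Qed.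

Lemma int_prod_neq0 s : int_prod s != 0.
Proof.
elim: s => [|i s]; first by rewrite /int_prod big_nil oner_neq0.
apply: contraNneq; rewrite /int_prod big_cons -/(int_prod s) => Js0; apply/eqP.
by rewrite -[LHS]mul1r -(mderiv_integration i) -mulrA Js0 mulr0.
Qed.

Lemma int_nilpotent_int_prod s : int_nilpotent (int_prod s).
Proof.
rewrite /int_prod; elim/big_ind: _ => [||i _]; first exact: int_nilpotent1.
  exact: int_nilpotentM.
exact: int_nilpotent_integration.
Qed.

Lemma int_nilpotent_shift w s : int_nilpotent w ->
  exists2 w', int_nilpotent w' & w * int_prod s = int_prod s * w'.
Proof.
elim: s w => [|i s IH] w wn.
  by exists w; rewrite // /int_prod big_nil mulr1 mul1r.
have [k wk] := wn; have [v vk e] := int_nilS wk i.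
have [|w' w'n e'] := IH (w + v); first by apply: int_nilpotentD => //; exists k.
by exists w'; rewrite // /int_prod big_cons mulrA e -mulrA e' mulrA.
Qed.

(** A product of integrations serves as a common denominator that cancels the
    derivations occurring in f.  The operators f for which one exists form a
    subalgebra: denominators commute with each other, and they can be pushed to
    the left of an [int_nilpotent] operator. *)
Lemma in_I_int_nilpotent f : f \in @in_I K n ->
  exists s, int_nilpotent (f * int_prod s).
Proof.
move=> /asboolP fI.
pose A : {pred E} := fun g => `[< exists s, int_nilpotent (g * int_prod s) >].
suff /asboolP : f \in A by [].
apply: fI => [|g [i [] ->]].
- split=> [|a g h /asboolP[s gs] /asboolP[t ht]
          |g h /asboolP[s gs] /asboolP[t ht]].
  + by apply/asboolP; exists [::]; rewrite mul1r; apply: int_nilpotent_int_prod.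
  + apply/asboolP; exists (s ++ t); rewrite mulrDl.
    apply: int_nilpotentD.
      rewrite -scalerAl int_prod_cat mulrA; apply: int_nilpotentZ.
      by apply: int_nilpotentM => //; apply: int_nilpotent_int_prod.
    rewrite int_prod_cat int_prodC mulrA.
    by apply: int_nilpotentM => //; apply: int_nilpotent_int_prod.
  + apply/asboolP; exists (t ++ s).
    have [w wn e] := int_nilpotent_shift s ht.
    by rewrite int_prod_cat -mulrA (mulrA h) e mulrA; apply: int_nilpotentM.
- apply/asboolP; exists [::]; rewrite /int_prod big_nil mulr1.
  exact: int_nilpotent_mul_var.
- apply/asboolP; exists [:: i]; rewrite /int_prod big_seq1 mderiv_integration.
  exact: int_nilpotent1.
- apply/asboolP; exists [::]; rewrite /int_prod big_nil mulr1.
  exact: int_nilpotent_integration.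
Qed.

(** * Ideals containing a regular element *)

Definition commutes_integrations w := forall i, w * J i = J i * w.

Lemma multinomial_eq0_or_succ (m : 'X_{1..n}) :
  m = 0%MM \/ exists i m', m = (m' + U_(i))%MM.
Proof.
have [->|m0] := eqVneq m 0%MM; [by left | right].
have [i mi|m_eq0] := pickP (fun i => m i != 0%N).
  by exists i, (m - U_(i))%MM; rewrite submK // lep1mP.
case/eqP: m0; apply/mnmP => i; rewrite mnm0E.
by have /negbFE/eqP := m_eq0 i.
Qed.

(** Up to a nonzero factor, each monomial is a product of integrations applied
    to 1. *)
Lemma commuting_eq0 w : commutes_integrations w -> w 1 = 0 -> w = 0.
Proof.
move=> wJ w1; apply: poly_end_eq_monomials => m; rewrite [RHS]/=.
have [d] := ubnP (mdeg m); elim: d m => // d IH m.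
have [->|[i [m' ->]]] := multinomial_eq0_or_succ m; first by rewrite mpolyX0.
rewrite mdegD mdeg1 addn1 ltnS => m'd.
have -> : 'X_[m' + U_(i)] = (m' i).+1%:R *: J i 'X_[m'].
  by rewrite /= integrationX scalerA mulfV // scale1r -mpolyXD addmC.
rewrite linearZ /=; have -> : w (J i 'X_[m']) = J i (w 'X_[m']).
  by have /(congr1 (fun g : E => g 'X_[m'])) := wJ i.
by rewrite IH // linear0 scaler0.
Qed.

Lemma mcoeff_mul_var i q m : (X i q)@_(m + U_(i)) = q@_m.
Proof. by rewrite /= /mul_var mulrC addmC mcoeffMX. Qed.

Lemma in_I_mul_var i : X i \in @in_I K n.
Proof. by apply: I_generator_in; exists i; apply: Or31. Qed.

Lemma in_I_mderiv i : D i \in @in_I K n.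
Proof. by apply: I_generator_in; exists i; apply: Or32. Qed.

Lemma in_I_integration i : J i \in @in_I K n.
Proof. by apply: I_generator_in; exists i; apply: Or33. Qed.

Lemma in_I_int_prod s : int_prod s \in @in_I K n.
Proof. by apply: rpred_prod => i _; apply: in_I_integration. Qed.

Definition I_ideal (A : set E) :=
  [/\ forall f g, A f -> A g -> A (f - g),
      forall f g, f \in @in_I K n -> A g -> A (f * g)
    & forall f g, f \in @in_I K n -> A g -> A (g * f)].

(** The last nonzero operator obtained from w by taking differences has all its
    differences equal to 0, that is, it commutes with the integrations. *)
Lemma ideal_commuting A k w : I_ideal A -> int_nil k w -> A w -> w != 0 ->
  exists w', [/\ A w', w' != 0 & commutes_integrations w'].
Proof.
move=> [AB AMl AMr]; elim: k w => [w ->|k IH w wk Aw w0]; first by rewrite eqxx.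
have [wJ|] := pselect (commutes_integrations w); first by exists w.
move=> /existsNP[i wJi]; have [v vk e] := wk i.
apply: (IH v) => //; last first.
  by apply: contra_notN wJi => /eqP v0; rewrite e v0 addr0.
have -> : v = D i * (w * J i) - w.
  by rewrite e mulrA mderiv_integration mul1r addrC addKr.
by apply: AB => //; apply: AMl (in_I_mderiv i) _; apply: AMr => //;
  apply: in_I_integration.
Qed.

(** The operator D_i (H w - w H), with H = X_i D_i, is again in A, again
    commutes with the integrations, and sends 1 to D_i X_i D_i (w 1) because H
    kills 1.  Its value at 1 has smaller degree than w 1, and is nonzero as soon
    as some monomial of w 1 involves x_i. *)
Lemma ideal_one A k w : I_ideal A -> A w -> w != 0 -> commutes_integrations w ->
  (forall m, (k <= mdeg m)%N -> (w 1)@_m = 0) -> A 1.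
Proof.
move=> [AB AMl AMr]; elim: k w => [w _ w0 wJ wdeg|k IH w Aw w0 wJ wdeg].
  case/eqP: w0; apply: commuting_eq0 => //; apply/mpolyP => m.
  by rewrite mcoeff0 wdeg.
have [[i [m wm]]|wcst] :=
    pselect (exists i m, (w 1)@_(m + U_(i)) != 0); last first.
  (* Here w 1 is constant, so that w is a scalar. *)
  pose c := (w 1)@_0.
  have w1 : w 1 = c%:MP.
    apply/mpolyP => m; rewrite mcoeffC.
    have [->|[i [m' ->]]] := multinomial_eq0_or_succ m.
      by rewrite eqxx mulr1.
    have -> : (w 1)@_(m' + U_(i)) = 0.
      by apply: contra_notP wcst => /eqP wm'; exists i, m'.
    by rewrite -mdeg_eq0 mdegD mdeg1 addn1 mulr0.
  have wc : w = c *: 1.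
    apply/eqP; rewrite -subr_eq0; apply/eqP; apply: commuting_eq0.
      by move=> i; rewrite mulrBl mulrBr wJ -scalerAl mul1r -scalerAr mulr1.
    have -> : (w - c *: 1) 1 = w 1 - c *: 1 by [].
    by rewrite w1 -mul_mpolyC mulr1 subrr.
  have c0 : c != 0 by apply: contraNneq w0 => c0; rewrite wc c0 scale0r.
  have -> : 1 = (c^-1 *: 1) * w.
    by rewrite wc -scalerAl mul1r scalerA mulVf // scale1r.
  by apply: AMl => //; rewrite rpredZ ?rpred1.
pose H := X i * D i; pose w' := D i * (H * w - w * H).
have H_I : H \in @in_I K n.
  by apply: rpredM; [apply: in_I_mul_var | apply: in_I_mderiv].
have w'1 m' : (w' 1)@_m' = (w 1)@_(m' + U_(i)) *+ (m' i).+1 *+ (m' i).+1.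
  have -> : w' 1 = D i (X i (D i (w 1)) - w (X i (D i 1))) by [].
  have -> : D i 1 = 0 by rewrite /= -mpolyC1 mderivC.
  rewrite (linear0 (X i)) (linear0 w) subr0 mcoeff_mderiv.
  by rewrite mcoeff_mul_var mcoeff_mderiv.
apply: (IH w').
- by apply: (AMl _ _ (in_I_mderiv i)); apply: AB; [apply: AMl | apply: AMr].
- apply: contraNneq wm => w'0; have := w'1 m; rewrite w'0 mcoeff0 -mulrnA.
  move/esym/eqP; rewrite -mulr_natr mulf_eq0 natrM mulf_eq0.
  by rewrite !(negbTE (natr_neq0 _)) !orbF.
- move=> j; have [<-|ij] := eqVneq i j.
    apply: commutator_commutes => //; first exact: mderiv_integration.
      exact: integration_mderiv_mul_var.
    exact: mderiv_mul_var.
  have HJ : H * J j = J j * H.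
    by rewrite -mulrA mderiv_integrationC // mulrA integration_mul_varC // mulrA.
  have cJ : (H * w - w * H) * J j = J j * (H * w - w * H).
    rewrite mulrBl mulrBr -(mulrA H w) wJ (mulrA H) HJ -(mulrA _ H w).
    by rewrite -(mulrA w H) HJ (mulrA w) wJ -(mulrA _ w H).
  by rewrite -mulrA cJ mulrA mderiv_integrationC // -mulrA.
- move=> m' km'; rewrite w'1 wdeg ?mul0rn //.
  by rewrite mdegD mdeg1 addn1.
Qed.

End Relations.

Lemma I_alg_regular_ideals_trivial (K : fieldType) (n : nat) :
  [pchar K] =i pred0 -> regular_ideals_trivial (I_alg K n).
Proof.
move=> char0 A c [AB AMl AMr] Ac reg_c.
pose A' : set (poly_end K n) := [set I_val a | a in A].
have idA' : I_ideal A'.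
  split=> [_ _ [a Aa <-] [b Ab <-]|f _ fI [a Aa <-]|f _ fI [a Aa <-]].
  - by exists (a - b); [apply: AB | ].
  - by exists (IAlg fI * a); [apply: AMl | ].
  - by exists (a * IAlg fI); [apply: AMr | ].
suff [a Aa a1] : A' 1 by have -> : 1 = a by apply: val_inj.
have [s [k csk]] := in_I_int_nilpotent char0 (I_valP c).
pose js := IAlg (in_I_int_prod K s).
have cs0 : I_val c * int_prod K s != 0.
  apply: contraNneq (int_prod_neq0 char0 s) => cs0.
  have cjs0 : c * js = 0 by apply: val_inj.
  by apply/eqP; have /(congr1 (@I_val K n)) := reg_c js cjs0.
have Acs : A' (I_val c * int_prod K s) by exists (c * js); first exact: AMr.
have [w [Aw w0 wJ]] := ideal_commuting char0 idA' csk Acs cs0.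
apply: (ideal_one char0 (k := msize (w 1)) idA' Aw w0 wJ) => m.
by move=> /msize_mdeg_ge/memN_msupp_eq0.
Qed.

Theorem theorem4p3 (K : fieldType) (char0 : [pchar K] =i pred0)
    (n : nat) (n_ge1 : (1 <= n)%N) :
  maximal_left_order (range (@Q_l_embed (I_alg K n))) /\
  maximal_right_order (range (@Q_r_embed (I_alg K n))).
Proof.
have trivial_I := @I_alg_regular_ideals_trivial K n char0.
by split; [apply: maximal_left_order_Q_l | apply: maximal_right_order_Q_r].
Qed.
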